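(* Let $X,Y,Z,W$ be locally convex Hausdorff topological vector spaces, $K\subset Y$ a proper closed convex cone with $\operatorname{int}K\ne\emptyset$, $P\subset W$ and $S\subset Z$ nonempty convex cones, $F\colon X\to Y^\infty$, $\kappa\colon W\to Y^\infty$, $H\colon X\to W^\infty$, $G\colon X\to Z^\infty$ proper mappings, $C\subset X$ nonempty, $A=C\cap G^{-1}(-S)$, and assume $A\cap\operatorname{dom}F\cap H^{-1}(\operatorname{dom}\kappa)\neq\emptyset$. Put $$\mathcal M^2=\bigcup_{T_1\in\operatorname{dom}\kappa^*,\; T_2\in\mathcal L_+^w(S,K)}\Psi\big(\mathfrak E\mathrm{pi}F^*\boxplus\mathfrak E\mathrm{pi}(T_1\circ H+T_2\circ G+I_C)^*\boxplus\{(0_{\mathcal L},\kappa^*(T_1)\uplus I_{-S}^*(T_2))\}\big),$$ $$\mathcal M^2_+=\bigcup_{T_1\in\operatorname{dom}\kappa^*\cap\mathcal L_+(P,K),\; T_2\in\mathcal L_+(S,K)}\Psi\big(\mathfrak E\mathrm{pi}F^*\boxplus\mathfrak E\mathrm{pi}(T_1\circ H+T_2\circ G+I_C)^*\boxplus\{(0_{\mathcal L},\kappa^*(T_1))\}\big).$$ For $(L,y)\in\mathcal L(X,Y)\times Y$ consider the assertions: $(\alpha')$ if $x\in C$ and $G(x)\in-S$, then $F(x)+(\kappa\circ H)(x)-L(x)+y\notin-\operatorname{int}K$; $(\delta')$ there exist $L'\in\mathcal L(X,Y)$, $T_1\in\operatorname{dom}\kappa^*$, $T_2\in\mathcal L_+^w(S,K)$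 such that for all $(x,x')\in X\times C$ $$F(x)-L'(x)+(T_1\circ H)(x')+(T_2\circ G)(x')-(L-L')(x')+y\notin\kappa^*(T_1)+T_2(-S)-\operatorname{int}K;$$ $(\epsilon')$ there exist $L'\in\mathcal L(X,Y)$, $T_1\in\operatorname{dom}\kappa^*\cap\mathcal L_+(P,K)$, $T_2\in\mathcal L_+(S,K)$ such that for all $(x,x')\in X\times C$ $$F(x)-L'(x)+(T_1\circ H)(x')+(T_2\circ G)(x')-(L-L')(x')+y\notin\kappa^*(T_1)-\operatorname{int}K.$$ Then: (1) $\operatorname{epi}(F+\kappa\circ H+I_A)^*=\mathcal M^2$ if and only if $(\alpha')\Leftrightarrow(\delta')$ for all $(L,y)\in\mathcal L(X,Y)\times Y$; (2) $\operatorname{epi}(F+\kappa\circ H+I_A)^*=\mathcal M^2_+$ if and only if $(\alpha')\Leftrightarrow(\epsilon')$ for all $(L,y)\in\mathcal L(X,Y)\times Y$.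
   Context: Ordering: $K$ proper means $K\neq Y$. $y_1<_K y_2$ iff $y_1-y_2\in-\operatorname{int}K$. $Y^\infty=Y\cup\{+\infty_Y\}$, $Y^\bullet=Y\cup\{\pm\infty_Y\}$, with $-\infty_Y<_Ky<_K+\infty_Y$ for $y\in Y$, $-\infty_Y<_K+\infty_Y$, $-(\pm\infty_Y)=\mp\infty_Y$, $y+(+\infty_Y)=+\infty_Y$ for $y\in Y^\infty$, $M+\{+\infty_Y\}=\{+\infty_Y\}$ for $M\subset Y$; similarly $W^\infty=W\cup\{+\infty_W\}$, $Z^\infty=Z\cup\{+\infty_Z\}$. For $M\subset Y^\bullet$: $\operatorname{WSup}M$ is the set of $\bar v\in Y^\bullet$ such that $\bar v\not<_Kv$ for all $v\in M$ and for every $\tilde v\in Y^\bullet$ with $\tilde v<_K\bar v$ there is $v\in M$ with $\tilde v<_Kv$. A mapping into $Y^\infty$ (or $W^\infty$, $Z^\infty$) is proper if its domain (set of points where it is not $+\infty$) is nonempty. $\kappa(+\infty_W)=+\infty_Y$. For $T\in\mathcal L(Z,Y)$ (continuous linear maps), $(T\circ G)(x)=T(G(x))$ if $G(x)\in Z$ and $+\infty_Y$ otherwise; likewise $T\circ H$. $I_D(x)=0_Y$ if $x\in D$, $+\infty_Y$ otherwise. $0_{\mathcal L}$ is the zero of $\mathcal L(X,Y)$. $\mathcal L_+(S,K)=\{T\in\mathcal L(Z,Y):T(S)\subset K\}$, $\mathcal L_+^w(S,K)=\{T\in\mathcal L(Z,Y):T(S)\cap(-\operatorname{int}K)=\emptyset\}$,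 and $\mathcal L_+(P,K)$ is defined analogously. Conjugates: for $E\colon X\to Y^\infty$, $E^*(L)=\operatorname{WSup}\{L(x)-E(x):x\in X\}$, $\operatorname{dom}E^*=\{L:E^*(L)\neq\{+\infty_Y\}\}$, $\operatorname{epi}E^*=\{(L,y)\in\mathcal L(X,Y)\times Y:y\in E^*(L)+K\}$; likewise for mappings on $W$, $Z$ ($\kappa^*$, $I_{-S}^*$). Set order: for nonempty $M,N\subset Y^\bullet$, $M\preccurlyeq_KN$ iff $v\not<_Ku$ for all $u\in M$, $v\in N$. $\mathcal P_p(Y)$ is the collection of $U\subset Y$ such that $Y$ is the disjoint union of $U-\operatorname{int}K$, $U$, $U+\operatorname{int}K$; $\mathcal P_p(Y)^\infty=\mathcal P_p(Y)\cup\{\{+\infty_Y\}\}$. For $U,V\in\mathcal P_p(Y)^\infty$, $U\uplus V=\operatorname{WSup}(U+V)$ (a commutative, associative operation). Extended epigraph: $\mathfrak E\mathrm{pi}E^*=\{(L,U)\in\mathcal L(X,Y)\times\mathcal P_p(Y):L\in\operatorname{dom}E^*,\ E^*(L)\preccurlyeq_KU\}$. $\mathscr M\boxplus\mathscr N=\{(L_1+L_2,U_1\uplus U_2):(L_1,U_1)\in\mathscr M,(L_2,U_2)\in\mathscr N\}$. $\Psi(L,U)=\{L\}\times U$ for $U\in\mathcal P_p(Y)$, and $\Psi(\mathscr M)=\bigcup_{(L,U)\in\mathscr M}\Psi(L,U)$; pairs $(L,\{+\infty_Y\})$ that may arise from $\uplus$ contribute the empty set to $\Psi$. *)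

(* Defs.v *)
From HB Require Import structures.
From mathcomp Require Import all_boot all_order all_algebra.
From mathcomp Require Import all_classical all_reals all_analysis.

Set Implicit Arguments.
Unset Strict Implicit.
Unset Printing Implicit Defensive.

Import Order.TTheory GRing.Theory Num.Theory.
Import numFieldNormedType.Exports.

Local Open Scope classical_set_scope.
Local Open Scope ring_scope.

(* The two-point extension of a space Y by -oo and +oo is the library's
   [\bar Y], with its addition and opposite; only the order is redefined.
   A mapping into Y with +oo adjoined is a function into [\bar Y] that never
   takes the value -oo; this is part of [proper_map].  Under that condition the
   library's value for -oo + +oo is never used.
   Subsets of the extended space have type [set (\bar Y)]; a subset V of Y is
   seen there as [EFin @` V]. *)

Definition opp_set (V : zmodType) (M : set V) : set V := -%R @` M.

Definition add_set (V : nmodType) (M N : set (\bar V)) : set (\bar V) :=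
  [set (u + v)%E | u in M & v in N].

(* Cones are stable under multiplication by positive scalars; membership of 0
   is not assumed. *)
Definition convex_cone (R : realType) (V : lmodType R) (M : set V) : Prop :=
  @convex_set R V M /\ forall (t : R) (x : V), 0 < t -> M x -> M (t *: x).

Section ExtendedMappings.
Context {U V : Type}.

Definition dom (E : U -> \bar V) : set U := [set x | E x <> +oo%E].

Definition proper_map (E : U -> \bar V) : Prop :=
  (forall x, E x <> -oo%E) /\ dom E !=set0.

(* f \o H, where f is extended by +oo at +oo; for a linear map T,
   T \o H is [ext_comp (EFin \o T) H]. *)
Definition ext_comp {T : Type} (f : V -> \bar T) (H : U -> \bar V) : U -> \bar T :=
  fun x => if H x is w%:E%E then f w else +oo%E.

End ExtendedMappings.

Definition indicator {U : Type} {V : nmodType} (D : set U) (x : U) : \bar V :=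
  if x \in D then 0%:E%E else +oo%E.

Section VectorOrder.
Context {R : realType} {Y : tvsType R}.
Variable K : set Y.

Definition ltK (u v : \bar Y) : Prop :=
  match u, v with
  | a%:E%E, b%:E%E => opp_set (interior K) (a - b)
  | _%:E%E, +oo%E | -oo%E, _%:E%E | -oo%E, +oo%E => True
  | _, _ => False
  end.

Definition WSup (M : set (\bar Y)) : set (\bar Y) :=
  [set v | (forall u, M u -> ~ ltK v u) /\
           (forall w, ltK w v -> exists2 u, M u & ltK w u)].

Definition set_le (M N : set (\bar Y)) : Prop :=
  forall u v, M u -> N v -> ~ ltK v u.

Definition Pp : set (set (\bar Y)) :=
  [set U | exists V : set Y,
     let lo := [set u - k | u in V & k in interior K] in
     let hi := [set u + k | u in V & k in interior K] in
     [/\ U = EFin @` V, lo `|` V `|` hi = setT,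
         lo `&` V = set0, V `&` hi = set0 & lo `&` hi = set0]].

Definition uplus (U V : set (\bar Y)) : set (\bar Y) := WSup (add_set U V).

End VectorOrder.

Section ContinuousLinearMaps.
Context {R : realType}.

Definition clin (U V : tvsType R) : set (U -> V) :=
  [set L | linear L /\ continuous L].

Definition clin_pos (U V : tvsType R) (S : set U) (K : set V) : set (U -> V) :=
  [set T | clin T /\ T @` S `<=` K].

Definition clin_wpos (U V : tvsType R) (S : set U) (K : set V) : set (U -> V) :=
  [set T | clin T /\ T @` S `&` opp_set (interior K) = set0].

End ContinuousLinearMaps.

Section Conjugates.
Context {R : realType} {U Y : tvsType R}.
Variable K : set Y.
Implicit Types (E : U -> \bar Y) (L : U -> Y).

Definition conjugate E L : set (\bar Y) :=
  WSup K (range (fun x => ((L x)%:E - E x)%E)).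

Definition dom_conjugate E : set (U -> Y) :=
  [set L | clin L /\ conjugate E L <> [set +oo%E]].

Definition epi_conjugate E : set ((U -> Y) * Y) :=
  [set p | clin p.1 /\ add_set (conjugate E p.1) (EFin @` K) p.2%:E%E].

Definition Epi_conjugate E : set ((U -> Y) * set (\bar Y)) :=
  [set p | [/\ dom_conjugate E p.1, Pp K p.2 &
               set_le K (conjugate E p.1) p.2]].

Definition boxplus (M N : set ((U -> Y) * set (\bar Y))) :
    set ((U -> Y) * set (\bar Y)) :=
  [set (p.1 + q.1, uplus K p.2 q.2) | p in M & q in N].

(* A pair (L, {+oo}) contributes nothing, since only finite y are collected. *)
Definition Psi (M : set ((U -> Y) * set (\bar Y))) : set ((U -> Y) * Y) :=
  \bigcup_(p in M) [set q | q.1 = p.1 /\ p.2 q.2%:E%E].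

End Conjugates.

Section CompositeProblem.
Context {R : realType} {X Y Z W : tvsType R}.
Variables (K : set Y) (P : set W) (S : set Z).
Variables (F : X -> \bar Y) (kappa : W -> \bar Y).
Variables (H : X -> \bar W) (G : X -> \bar Z) (C : set X).

Definition feasible : set X := C `&` G @^-1` (EFin @` opp_set S).

Definition objective : X -> \bar Y :=
  (F \+ ext_comp kappa H \+ indicator feasible)%E.

Definition lagrangian (T1 : W -> Y) (T2 : Z -> Y) : X -> \bar Y :=
  (ext_comp (EFin \o T1) H \+ ext_comp (EFin \o T2) G \+ indicator C)%E.

Definition M2 : set ((X -> Y) * Y) :=
  \bigcup_(T1 in dom_conjugate K kappa) \bigcup_(T2 in clin_wpos S K)
    Psi (boxplus K
           (boxplus K (Epi_conjugate K F) (Epi_conjugate K (lagrangian T1 T2)))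
           [set (0, uplus K (conjugate K kappa T1)
                      (conjugate K (indicator (opp_set S)) T2))]).

Definition M2_pos : set ((X -> Y) * Y) :=
  \bigcup_(T1 in dom_conjugate K kappa `&` clin_pos P K)
  \bigcup_(T2 in clin_pos S K)
    Psi (boxplus K
           (boxplus K (Epi_conjugate K F) (Epi_conjugate K (lagrangian T1 T2)))
           [set (0, conjugate K kappa T1)]).

Definition assertion_alpha (L : X -> Y) (y : Y) : Prop :=
  forall x, C x -> (EFin @` opp_set S) (G x) ->
  ~ (EFin @` opp_set (interior K))
      (F x + ext_comp kappa H x - (L x)%:E + y%:E)%E.

Definition decoupled (L L' : X -> Y) (T1 : W -> Y) (T2 : Z -> Y) (y : Y)
    (x x' : X) : \bar Y :=
  (F x - (L' x)%:E + ext_comp (EFin \o T1) H x' + ext_comp (EFin \o T2) G x'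
     - ((L - L') x')%:E + y%:E)%E.

Definition assertion_delta (L : X -> Y) (y : Y) : Prop :=
  exists L' T1 T2,
  [/\ clin L', dom_conjugate K kappa T1, clin_wpos S K T2 &
      forall x x', C x' ->
      ~ add_set (add_set (conjugate K kappa T1) (EFin @` (T2 @` opp_set S)))
          (EFin @` opp_set (interior K)) (decoupled L L' T1 T2 y x x')].

Definition assertion_epsilon (L : X -> Y) (y : Y) : Prop :=
  exists L' T1 T2,
  [/\ clin L', dom_conjugate K kappa T1 /\ clin_pos P K T1, clin_pos S K T2 &
      forall x x', C x' ->
      ~ add_set (conjugate K kappa T1) (EFin @` opp_set (interior K))
          (decoupled L L' T1 T2 y x x')].

End CompositeProblem.

(* Main.v *)
(** A nonempty [M] in the extended space is governed by its strict lower set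
    [lower M = M - int K]: the finite points of [WSup M] are exactly the
    frontier of [lower M], passing to [WSup M] does not change [lower M], and
    [lower] turns addition of sets into Minkowski addition.  Hence [(L, y)] lies
    in the epigraph of [E^*] iff [y] is not in [lower {L x - E x}], which for the
    objective is (alpha'); and membership in [M2], [M2_pos] amounts to [y]
    avoiding
    [lower {L' x - F x} + lower {(L - L') x' - lagrangian x'} + lower N], where
    [N] is the set subtracted in (delta'), (epsilon').  Both equivalences are
    then comparisons of two sets of pairs. *)

Require Import Defs.
From mathcomp Require Import all_boot all_order all_algebra.
From mathcomp Require Import all_classical all_reals all_analysis.
From mathcomp Require Import ssrAC lra.
Set Implicit Arguments.
Unset Strict Implicit.
Unset Printing Implicit Defensive.
Import Order.TTheory GRing.Theory Num.Theory.
Import numFieldNormedType.Exports.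
Local Open Scope classical_set_scope.
Local Open Scope ring_scope.

(** * Convex cones and their interiors in a topological vector space *)

Section ConeTopology.
Context {R : realType} {Y : tvsType R} (K : set Y).
Context (coneK : convex_cone K).

(** The sum is twice the midpoint, which convexity puts in [K]. *)
Lemma convex_cone_add x y : K x -> K y -> K (x + y).
Proof.
move=> Kx Ky; have [cK sK] := coneK.
have h : 0 <= 2^-1 :> R by rewrite invr_ge0.
have h1 : 2^-1 <= 1 :> R by rewrite invf_le1 ?ler1n.
have /set_mem/(sK 2 _ (ltr0n _ 2)) :=
  cK x y (Itv01 h h1) (mem_set Kx) (mem_set Ky).
have -> : conv (Itv01 h h1) (x : convex_lmodType Y) (y : convex_lmodType Y) =
    2^-1 *: x + (1 - 2^-1) *: y by [].
have e : 2 * (1 - 2^-1) = 1 :> R by lra.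
by rewrite scalerDr !scalerA e mulfV ?pnatr_eq0// !scale1r.
Qed.

(** Translation by [- k] is continuous, so [K], a neighbourhood of [x], pulls back to a
    neighbourhood of [k + x]; adding [k] back stays in the cone. *)
Lemma add_interior k x : K k -> interior K x -> interior K (k + x).
Proof.
move=> Kk Ix.
have c : (fun z => z - k) @ (k + x) --> x.
  rewrite (addrC k) -[X in _ --> X](addrK k x).
  apply: (@continuous_comp _ _ _ (fun z => (z, k))
    (fun z : Y * Y => z.1 - z.2)).
    by apply: cvg_pair => /=; [exact: cvg_id|exact: cvg_cst].
  exact: sub_continuous.
have : nbhs (k + x) ((fun z => z - k) @^-1` K) := c K Ix.
apply: filterS => z /= Kz.
by rewrite -(subrK k z); exact: convex_cone_add.
Qed.

Lemma scale_interior (t : R) x : 0 < t -> interior K x -> interior K (t *: x).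
Proof.
move=> t0 Ix.
have c : (fun z => t^-1 *: z) @ (t *: x) --> x.
  rewrite -[X in _ --> X](scale1r x) -(mulVf (lt0r_neq0 t0)) -scalerA.
  apply: (@continuous_comp _ _ _ (fun z => (t^-1, z))
    (fun z : R^o * Y => z.1 *: z.2)).
    by apply: (@cvg_pair _ _ _ _ (nbhs (t^-1 : R^o)));
      [exact: cvg_cst|exact: cvg_id].
  exact: scale_continuous.
have : nbhs (t *: x) (( *:%R t^-1) @^-1` K) := c K Ix.
apply: filterS => z /= /((proj2 coneK) t _ t0).
by rewrite scalerA mulfV ?scale1r ?lt0r_neq0.
Qed.

Lemma cvg_line (k v : Y) : (fun t : R^o => k + t *: v) @ (0 : R^o) --> k.
Proof.
rewrite -[X in _ --> X]addr0 -(scale0r v).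
apply: (@continuous_comp _ _ _ (fun t : R^o => (k, t *: v))
  (fun x : Y * Y => x.1 + x.2)); last exact: add_continuous.
apply: cvg_pair => /=; first exact: cvg_cst.
apply: (@continuous_comp _ _ _ (fun t : R^o => (t, v))
  (fun x : R^o * Y => x.1 *: x.2)); last exact: scale_continuous.
by apply: (@cvg_pair _ _ _ _ (nbhs (0 : R^o))) => /=;
  [exact: cvg_id|exact: cvg_cst].
Qed.

Lemma nbhs_line (B : set Y) k v :
  nbhs k B -> exists2 t : R, 0 < t & B (k + t *: v).
Proof.
move=> /(@cvg_line k v)/nbhs_ballP[/= d d0 dB].
exists (d / 2); first by rewrite divr_gt0.
apply: (dB (d / 2)); rewrite /ball /= sub0r normrN gtr0_norm ?divr_gt0//.
by rewrite ltr_pdivrMr// mulr_natr mulr2n ltrDl.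
Qed.

Lemma interior_absorbs k v :
  interior K k -> exists2 t : R, 0 < t & interior K (k + t *: v).
Proof. by move=> Ik; apply: nbhs_line; exact: nbhs_interior. Qed.

(** A short step from [k] along [v] stays in the interior; rescaling by the inverse step length
    leaves [v] itself plus a multiple of [k]. *)
Lemma interior_dominates k v :
  interior K k -> exists2 t : R, 0 < t & interior K (t *: k + v).
Proof.
move=> /(interior_absorbs v)[t t0 It]; have t'0 : 0 < t^-1 by rewrite invr_gt0.
exists t^-1 => //; have := scale_interior t'0 It.
by rewrite scalerDr scalerA mulVf ?scale1r ?lt0r_neq0.
Qed.

(** [convex_cone] does not provide [0]; closedness does, since every neighbourhood of [0] meets the
    open ray through a point of [K]. *)
Lemma closed_cone0 : closed K -> interior K !=set0 -> K 0.
Proof.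
move=> clK [e /interior_subset Ke].
apply: clK => B /(nbhs_line e)[t t0 Bt]; exists (0 + t *: e); split=> //.
by rewrite add0r; exact: (proj2 coneK).
Qed.
End ConeTopology.

(** * Strict lower sets, their frontiers and weak suprema *)

Section StrictLowerSets.
Context {R : realType} {Y : tvsType R} (K : set Y).
Implicit Types (M N U : set (\bar Y)) (A B D : set Y) (y v w k : Y).

Definition lower M : set Y := [set y | exists2 u, M u & ltK K y%:E u].

Definition minkowski A B : set Y := [set a + b | a in A & b in B].

(** For the open, downward closed set [lower M] this is the topological boundary, expressed through
    the order instead of limits. *)
Definition frontier D : set Y :=
  [set v | ~ D v /\ forall k, interior K k -> D (v - k)].

Lemma ltK_fin y v : ltK K y%:E v%:E <-> interior K (v - y).
Proof.
rewrite /ltK /opp_set /=; split => [[k Ik e]|Ik].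
  by rewrite -opprB -e opprK.
by exists (v - y); rewrite ?opprB.
Qed.

Lemma minkowskiS A A' B B' :
  A `<=` A' -> B `<=` B' -> minkowski A B `<=` minkowski A' B'.
Proof.
by move=> AA BB _ [a /AA Aa [b /BB Bb <-]]; exists a => //; exists b.
Qed.

Lemma minkowski_neq0 A B : A !=set0 -> B !=set0 -> minkowski A B !=set0.
Proof. by move=> [a Aa] [b Bb]; exists (a + b); exists a => //; exists b. Qed.

Lemma minkowskiTl B : B !=set0 -> minkowski setT B = setT.
Proof.
move=> [b Bb]; apply/seteqP; split=> // y _.
by exists (y - b) => //; exists b; rewrite ?subrK.
Qed.

Lemma minkowskiTr A : A !=set0 -> minkowski A setT = setT.
Proof.
move=> [a Aa]; apply/seteqP; split=> // y _.
by exists a => //; exists (y - a); rewrite // addrC subrK.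
Qed.

Context (coneK : convex_cone K) (closedK : closed K)
  (intK : interior K !=set0).

Lemma interior_add k k' :
  interior K k -> interior K k' -> interior K (k + k').
Proof. by move=> /interior_subset; exact: add_interior. Qed.

Lemma lower_down M y k : K k -> lower M y -> lower M (y - k).
Proof.
move=> Kk [[u| |]// Mu yu]; last by exists +oo%E.
exists u%:E%E => //; apply/ltK_fin; move/ltK_fin: yu.
by rewrite opprB addrCA; exact: add_interior.
Qed.

Lemma lower_open M y v :
  lower M y -> exists2 t : R, 0 < t & lower M (y + t *: v).
Proof.
move=> [[u| |]// Mu yu]; last by exists 1 => //; exists +oo%E.
have /ltK_fin/(interior_absorbs (- v))[t t0 It] := yu.
exists t => //; exists u%:E%E => //; apply/ltK_fin.
by rewrite opprD addrA -scalerN.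
Qed.

Lemma lower_reaches M y k : interior K k -> lower M !=set0 ->
  exists2 t : R, 0 < t & lower M (y - t *: k).
Proof.
move=> Ik [d Dd]; have [t t0 It] := interior_dominates coneK (d - y) Ik.
exists t => //; have := lower_down (interior_subset It) Dd.
by rewrite addrCA opprD opprB addrA addrA addrAC subrr add0r addrC.
Qed.

Lemma lowerD M N : lower (add_set M N) = minkowski (lower M) (lower N).
Proof.
have [e Ie] := intK.
have low_fin L u : L u%:E%E -> lower L (u - e).
  by exists u%:E%E => //; apply/ltK_fin; rewrite opprB addrC subrK.
have low_oo L y : L +oo%E -> lower L y by exists +oo%E.
apply/seteqP; split=> [y [_ [u Mu [v Nv <-]]]|_ [a [u Mu au] [b [v Nv bv] <-]]].
  (* A summand [-oo] makes the sum [-oo], with nothing strictly below it; four cases remain. *)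
  case: u v Mu Nv => [u| |] [v| |]//= Mu Nv yuv.
  (* Each summand gives up half of the gap [u + v - y]. *)
  - move/ltK_fin: yuv => /(scale_interior coneK (t := 2^-1)) I2.
    have {}I2 : interior K (2^-1 *: (u + v - y)) by apply: I2; rewrite invr_gt0.
    set h := 2^-1 *: _ in I2.
    exists (u - h); [|exists (v - h)].
    + by exists u%:E%E => //; apply/ltK_fin; rewrite opprB addrC subrK.
    + by exists v%:E%E => //; apply/ltK_fin; rewrite opprB addrC subrK.
    + rewrite addrACA -opprD /h -scalerDl.
      have -> : 2^-1 + 2^-1 = 1 :> R by lra.
      by rewrite scale1r opprB addrC subrK.
  (* The finite summand is lowered by [e]; [+oo] lies above whatever remains of [y]. *)
  - exists (u - e); first exact: low_fin.
    by exists (y - (u - e)); [exact: low_oo | rewrite addrCA subrr addr0].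
  - exists (y - (v - e)); first exact: low_oo.
    by exists (v - e); [exact: low_fin | rewrite subrK].
  - by exists y; [exact: low_oo | exists 0; [exact: low_oo | rewrite addr0]].
exists (u + v)%E; first by exists u => //; exists v.
case: u v Mu Nv au bv => [u| |] [v| |]//= Mu Nv /ltK_fin au /ltK_fin bv.
by apply/ltK_fin; rewrite opprD addrACA; exact: interior_add.
Qed.

Lemma lower_shift M w :
  lower (add_set M [set w%:E%E]) = [set y | lower M (y - w)].
Proof.
apply/seteqP; split=> y.
  move=> [_ [u Mu [_ -> <-]] yu]; case: u Mu yu => [u| |]//= Mu yu.
    exists u%:E%E => //.
    by move/ltK_fin: yu => yu; apply/ltK_fin; rewrite opprB addrA.
  by exists +oo%E.
move=> [[u| |]// Mu yu].
  exists (u + w)%:E%E; first by exists u%:E%E => //; exists w%:E%E.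
  by move/ltK_fin: yu; rewrite opprB addrA => yu; apply/ltK_fin.
by exists +oo%E => //; exists +oo%E => //; exists w%:E%E.
Qed.

(** Along the ray [y - t *: e] the parameters that give points of [lower M] are upward closed, and
    their infimum is the required [t]. *)
Lemma frontier_reached M y e : interior K e -> lower M !=set0 -> ~ lower M y ->
  exists2 t : R, 0 <= t & frontier (lower M) (y - t *: e).
Proof.
move=> Ie M0 My; have Ke := interior_subset Ie.
have mono (s t : R) : s < t -> lower M (y - s *: e) -> lower M (y - t *: e).
  move=> st /(lower_down ((proj2 coneK) (t - s) _ _ Ke)).
  by rewrite subr_gt0 => /(_ st); rewrite -addrA -opprD -scalerDl
    (addrC s) subrK.
pose A : set R := [set t | 0 <= t /\ lower M (y - t *: e)].
have A0 : A !=set0.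
  by have [t t0 Mt] := lower_reaches y Ie M0; exists t; split=> //; exact: ltW.
have lA : lbound A 0 by move=> t [].
have hA : has_inf A by split=> //; exists 0.
have above t : inf A < t -> lower M (y - t *: e).
  rewrite -subr_gt0 => it; have [s [_ Ms]] := inf_adherent it hA.
  by rewrite addrC subrK => /mono; exact.
exists (inf A); first exact: lb_le_inf.
split=> [Mi|k Ik].
  (* If the infimum were attained, openness would allow a smaller parameter: a nonnegative one
     contradicts minimality, a negative one puts [y] itself in [lower M]. *)
  have [t t0] := lower_open e Mi.
  rewrite -addrA (_ : _ + t *: e = - ((inf A - t) *: e)); last first.
    by rewrite scalerBl opprB addrC.
  have [it|it] := leP 0 (inf A - t).
    move=> Mt; have : inf A <= inf A - t by apply: ge_inf => //; exists 0.
    by rewrite lerBrDr gerDl leNgt t0.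
  by move=> /(mono _ _ it); rewrite scale0r subr0.
(* Subtracting [k] goes further down than a short extra step along [e], which already enters
   [lower M]. *)
have [t t0 It] := interior_absorbs (- e) Ik.
have : lower M (y - (inf A + t) *: e) by apply: above; rewrite ltrDl.
move=> /(lower_down (interior_subset It)).
by rewrite scalerN scalerDl opprD -2!addrA -opprD (addrC (t *: e)) subrK -addrA.
Qed.

(** Going up from [y] along [e] eventually leaves [lower M], because some [b] lies outside it;
    [frontier_reached] then leads back down to the frontier. *)
Lemma frontier_lower M y : lower M !=set0 -> lower M <> setT ->
  lower M y -> exists2 k, interior K k & frontier (lower M) (y + k).
Proof.
move=> M0 MT My; have [e Ie] := intK; have Ke := interior_subset Ie.
have [b Mb] : exists b, ~ lower M b.
  by apply: contrapT => /forallNP h; apply: MT; apply/seteqP; split=> // z _;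
    exact: contrapT.
have [s s0 Is] := interior_dominates coneK (y - b) Ie.
have : ~ lower M (y + s *: e).
  move=> /(lower_down (interior_subset Is)).
  by rewrite opprD addrA addrK opprB addrCA subrr addr0.
move=> /(frontier_reached Ie M0)[t t0 Ft].
(* Descending by [s] or more would give a frontier point at or below [y], hence inside [lower M]. *)
have [ts|st] := ltP t s.
  exists ((s - t) *: e); first by apply: scale_interior; rewrite ?subr_gt0.
  by rewrite scalerBl addrA.
have [+ _] := Ft; case.
rewrite -addrA -scalerBl; move: st; rewrite le_eqVlt => /predU1P[->|st].
  by rewrite subrr scale0r addr0.
rewrite -opprB scaleNr; apply: lower_down => //.
by apply: (proj2 coneK); rewrite ?subr_gt0.
Qed.

(** Every finite point, and so [-oo] too, has an element of [M] strictly above it; only [+oo]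
    survives. *)
Lemma WSup_total M : lower M = setT -> WSup K M = [set +oo%E].
Proof.
move=> MT; have low y : exists2 u, M u & ltK K y%:E u 
  by have : lower M y by rewrite MT.
apply/seteqP; split=> [[v| |]//= [vM Mv]|_ ->].
- by have [u /vM] := low v.
- by have [[u| |]// Mu _] := low 0; case: (vM _ Mu).
split=> [[u| |] _ []|[w| |]// _].
by have [[u| |]// Mu _] := low 0; [exists u%:E%E|exists +oo%E].
Qed.

(** As a supremum, [+oo] would make [lower M] total and [-oo] would have an element of [M] above it;
    for finite points the two clauses of [WSup] are those of [frontier]. *)
Lemma WSup_proper M : lower M !=set0 -> lower M <> setT ->
  WSup K M = EFin @` frontier (lower M).
Proof.
move=> [d [m Mm dm]] MT.
have m_oo : m <> -oo%E by move=> mE; rewrite mE in dm.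
apply/seteqP; split=> [[v| |] [vM Mv]|_ [v [Mv Fv] <-]].
- exists v => //; split=> [[u /vM]//|k Ik]; apply: Mv; apply/ltK_fin.
  by rewrite opprB addrC subrK.
- by case: MT; apply/seteqP; split=> // y _; exact: (Mv y%:E%E).
- by have := vM _ Mm; case: m {Mm} dm m_oo => //= ? _ _ [].
split=> [u Mu vu|[w /ltK_fin/Fv|//|_]].
- by apply: Mv; exists u.
- by rewrite opprB addrC subrK.
- by exists m => //; case: m {Mm} dm m_oo.
Qed.

Lemma WSup_fin M y : lower M !=set0 ->
  WSup K M y%:E%E <-> frontier (lower M) y.
Proof.
move=> M0; have [MT|MT] := pselect (lower M = setT).
  by rewrite WSup_total//; split=> // -[My _]; case: My; rewrite MT.
by rewrite WSup_proper//; split=> [[v Fv [<-]]//|Fy]; exists y.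
Qed.

Lemma lower_WSup M : lower M !=set0 -> lower (WSup K M) = lower M.
Proof.
move=> M0; have [MT|MT] := pselect (lower M = setT).
  by rewrite WSup_total// MT; apply/seteqP; split=> // y _; exists +oo%E.
rewrite WSup_proper//; apply/seteqP; split=> y.
  move=> [_ [v [_ Fv] <-]] /ltK_fin/Fv.
  by rewrite opprB addrC subrK.
move=> /(frontier_lower M0 MT)[k Ik Fk].
exists (y + k)%:E%E; first by exists (y + k).
by apply/ltK_fin; rewrite addrC addKr.
Qed.

(** A point lies in [lower M], on its frontier or above it. The pieces are disjoint since
    subtracting interior vectors from the frontier lands in [lower M]. *)
Lemma WSup_Pp M : lower M !=set0 -> lower M <> setT -> Pp K (WSup K M).
Proof.
move=> M0 MT; exists (frontier (lower M)); split.
- exact: WSup_proper.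
- apply/seteqP; split=> // y _; have [My|My] := pselect (lower M y).
    have [k Ik Fk] := frontier_lower M0 MT My.
    by left; left; exists (y + k) => //; exists k; rewrite ?addrK.
  have [e Ie] := intK; have [t t0 Ft] := frontier_reached Ie M0 My.
  move: t0; rewrite le_eqVlt => /predU1P[t0|t0].
    by left; right; move: Ft; rewrite -t0 scale0r subr0.
  right; exists (y - t *: e) => //; exists (t *: e); rewrite ?subrK//.
  exact: scale_interior.
- apply/seteqP; split=> // _ [[v [_ Fv] [k Ik <-]] [+ _]].
  by case; exact: Fv.
- apply/seteqP; split=> // z [[_ Fz] [w [Mw _] [k Ik wz]]].
  by apply: Mw; rewrite -(addrK k w) wz; exact: Fz.
- apply/seteqP; split=> // _ [[v [_ Fv] [k Ik <-]] [w [Mw _] [l Il]]].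
  move=> /(canRL (addrK _)) wE; apply: Mw; rewrite wE -addrA -opprD.
  by apply: Fv; exact: interior_add.
Qed.

Lemma Pp_neq0 U : Pp K U -> lower U !=set0.
Proof.
have [e Ie] := intK.
move=> [V [-> VT _ _ _]].
have [v Vv] : V !=set0.
  by have : setT (0 : Y) by []; rewrite -VT => -[[[v ? _]|]|[v ? _]];
    [exists v|exists 0|exists v].
exists (v - e); exists v%:E%E; first by exists v.
by apply/ltK_fin; rewrite opprB addrC subrK.
Qed.

(** By the partition of [Y], a point not strictly below [U] lies in [U] or strictly above it; then
    an element of [M] above that point would exceed an element of [U]. *)
Lemma set_le_lower M U : Pp K U -> set_le K M U -> lower M `<=` lower U.
Proof.
move=> [V [-> VT _ _ _]] MU y [u Mu yu].
have : setT y by []; rewrite -VT => -[[[v Vv [k Ik <-]]|Vy]|[v Vv [k Ik yE]]].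
- exists v%:E%E; first by exists v.
  by apply/ltK_fin; rewrite opprB addrC subrK.
- by have := MU u y%:E%E Mu; case=> //; exists y.
- have := MU u v%:E%E Mu; case; first by exists v.
  case: u {Mu} yu => [u| |]// /ltK_fin uy; apply/ltK_fin.
  have := interior_add uy Ik.
  by rewrite -yE opprD addrA subrK.
Qed.

Lemma set_le_WSup M N : lower M !=set0 -> lower M `<=` lower N ->
  set_le K (WSup K M) (WSup K N).
Proof.
move=> M0 MN u [v| |] Mu [Nv _] vu; last 2 first.
- by case: u vu {Mu}.
- by have [y /MN[[n| |]// Nn _]] := M0; case: (Nv _ Nn).
have /MN[n /Nv] : lower M v by rewrite -lower_WSup//; exists u.
by [].
Qed.

Lemma WSup_addK M y : lower M !=set0 ->
  add_set (WSup K M) (EFin @` K) y%:E%E <-> ~ lower M y.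
Proof.
move=> M0; split.
  move=> [u Mu [_ [k Kk <-]]]; case: u Mu => [u| |]// /(WSup_fin _ M0)[Mu _].
  by move=> [<-] /(lower_down Kk); rewrite addrK.
move=> My; have [e Ie] := intK; have [t t0 Ft] := frontier_reached Ie M0 My.
exists (y - t *: e)%:E%E; first exact/WSup_fin.
exists (t *: e)%:E%E; last by congr EFin; exact: subrK.
(* When [y] is already on the frontier, [t = 0] and the vector added is [0], which belongs to [K] by
   closedness. *)
exists (t *: e) => //; move: t0; rewrite le_eqVlt => /predU1P[<-|t0].
  by rewrite scale0r; exact: closed_cone0.
by apply: (proj2 coneK) => //; exact: interior_subset.
Qed.
End StrictLowerSets.

(** * Sums and differences of continuous linear maps *)

Section ContinuousLinear.
Context {R : realType} {U V : tvsType R}.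

Lemma clinD (L1 L2 : U -> V) : clin L1 -> clin L2 -> clin (L1 + L2).
Proof.
move=> [l1 c1] [l2 c2]; split=> [a u v|x].
  by rewrite /= !fctE l1 l2 scalerDr addrACA.
apply: (@continuous_comp _ _ _ (fun z => (L1 z, L2 z))
  (fun z : V * V => z.1 + z.2)); last exact: add_continuous.
by apply: cvg_pair; [exact: c1|exact: c2].
Qed.

Lemma clinB (L1 L2 : U -> V) : clin L1 -> clin L2 -> clin (L1 - L2).
Proof.
move=> c1 [l2 c2]; apply: clinD => //; split=> [a u v|x].
  by rewrite /= !fctE l2 opprD scalerN.
by apply: (@continuous_comp _ _ _ L2 -%R); [exact: c2|exact: opp_continuous].
Qed.
End ContinuousLinear.

(** * Conjugates, epigraphs and sums of extended epigraphs *)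

Section Conjugates.
Context {R : realType} {U Y : tvsType R} (K : set Y).
Context (coneK : convex_cone K) (intK : interior K !=set0).
Implicit Types (E : U -> \bar Y) (L : U -> Y).

Definition values E L : set (\bar Y) := range (fun x => ((L x)%:E - E x)%E).

Lemma lower_values_neq0 E L : dom E !=set0 -> lower K (values E L) !=set0.
Proof.
have [e Ie] := intK; move=> [x]; rewrite /dom /=.
case Ex : (E x) => [a| |]// _.
  exists (L x - a - e); exists (L x - a)%:E%E; first by exists x; rewrite // Ex.
  by apply/ltK_fin; rewrite opprB addrC subrK.
(* Here [E x = -oo] is not excluded; it produces the value [+oo]. *)
by exists 0; exists +oo%E => //; exists x; rewrite // Ex.
Qed.

Lemma lower_conjugate E L :
  dom E !=set0 -> lower K (conjugate K E L) = lower K (values E L).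
Proof. by move=> dE; apply: lower_WSup => //; exact: lower_values_neq0. Qed.

Lemma dom_conjugateP E L : dom E !=set0 ->
  dom_conjugate K E L <-> clin L /\ lower K (values E L) <> setT.
Proof.
move=> dE; split=> -[cL h]; split=> //.
  by move=> /WSup_total WT; apply: h.
move=> cT; apply: h; rewrite -lower_conjugate// cT.
by apply/seteqP; split=> // y _; exists +oo%E.
Qed.

Lemma dom_conjugate_fin E L u : dom E !=set0 ->
  dom_conjugate K E L -> conjugate K E L u -> exists v, u = v%:E%E.
Proof.
move=> dE /(dom_conjugateP _ dE)[_ LT].
rewrite /conjugate WSup_proper//; last exact: lower_values_neq0.
by move=> [v _ <-]; exists v.
Qed.

Lemma epi_conjugateP E L y : closed K -> dom E !=set0 ->
  epi_conjugate K E (L, y) <-> clin L /\ ~ lower K (values E L) y.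
Proof.
move=> clK dE.
by split=> -[cL /WSup_addK h]; split=> //; apply: h => //;
  exact: lower_values_neq0.
Qed.

Lemma lower_uplus (M N : set (\bar Y)) :
  lower K M !=set0 -> lower K N !=set0 ->
  lower K (uplus K M N) = minkowski (lower K M) (lower K N).
Proof.
move=> M0 N0; rewrite lower_WSup ?lowerD//; exact: minkowski_neq0.
Qed.

Lemma uplus_fin (M N : set (\bar Y)) y :
  lower K M !=set0 -> lower K N !=set0 ->
  uplus K M N y%:E%E <-> frontier K (minkowski (lower K M) (lower K N)) y.
Proof.
by move=> M0 N0; rewrite -lowerD//; apply: WSup_fin; rewrite lowerD//;
  exact: minkowski_neq0.
Qed.

(* Enlarging [E1^*(L')] by a shift along an interior direction moves [y], which
   is not strictly below the sum, onto its boundary. *)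
Lemma Psi_boxplusP E1 E2 (N : set (\bar Y)) L y :
  dom E1 !=set0 -> dom E2 !=set0 -> lower K N !=set0 ->
  Psi (boxplus K (boxplus K (Epi_conjugate K E1) (Epi_conjugate K E2))
         [set (0, N)]) (L, y) <->
  clin L /\ exists2 L', clin L' &
    ~ lower K (add_set (add_set (values E1 L') (values E2 (L - L'))) N) y.
Proof.
move=> d1 d2 N0; split.
  move=> [_ [_ [[L1 U1] [dL1 P1 le1] [[L2 U2] [dL2 P2 le2] <-]] [_ -> <-]]].
  move=> [/= ->]; rewrite addr0.
  have U10 := Pp_neq0 intK P1; have U20 := Pp_neq0 intK P2.
  rewrite uplus_fin// lower_uplus//; last exact: minkowski_neq0.
  move=> [yU _].
  have [cL1 _] := dL1; have [cL2 _] := dL2.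
  split; first exact: clinD.
  exists L1 => //; rewrite (addrC L1) addrK !lowerD// => y12; apply: yU.
  move: y12; apply: minkowskiS => //; apply: minkowskiS.
    by rewrite -(lower_conjugate _ d1); exact: set_le_lower.
  by rewrite -(lower_conjugate _ d2); exact: set_le_lower.
move=> [cL [L' cL' yN]].
set M1 := values E1 L' in yN *; set M2 := values E2 (L - L') in yN *.
have M10 : lower K M1 !=set0 by exact: lower_values_neq0.
have M20 : lower K M2 !=set0 by exact: lower_values_neq0.
have tot0 : lower K (add_set (add_set M1 M2) N) !=set0.
  by rewrite !lowerD//; apply: minkowski_neq0 => //; exact: minkowski_neq0.
have [e Ie] := intK.
have [t t0 [yF Fy]] := frontier_reached coneK Ie tot0 yN.
set w := t *: e in yF Fy.
(* This says that shifting [M1] by [w] only enlarges its lower set, as the extended epigraph of [E1]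
   requires; [w] may be [0]. *)
have Kw z : lower K M1 z -> lower K M1 (z - w).
  move: t0; rewrite le_eqVlt => /predU1P[t0|t0].
    by rewrite /w -t0 scale0r subr0.
  by apply: lower_down => //; apply: (proj2 coneK) => //;
    exact: interior_subset.
(* A total summand would make the whole Minkowski sum total, and [y] would belong to it. *)
have M1T : lower K M1 <> setT.
  move=> MT; apply: yN; rewrite !lowerD// MT.
  by rewrite minkowskiTl// minkowskiTl.
have M2T : lower K M2 <> setT.
  move=> MT; apply: yN; rewrite !lowerD// MT.
  by rewrite minkowskiTr// minkowskiTl.
pose M1w := add_set M1 [set w%:E%E].
have lowM1w : lower K M1w = [set z | lower K M1 (z - w)] by exact: lower_shift.
have M1w0 : lower K M1w !=set0.
  by have [z Mz] := M10; exists (z + w); rewrite lowM1w /= addrK.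
have M1wT : lower K M1w <> setT.
  move=> MT; apply: M1T; apply/seteqP; split=> // z _.
  have : lower K M1w (z + w) by rewrite MT.
  by rewrite lowM1w /= addrK.
have mink_shift z :
    minkowski (minkowski (lower K M1w) (lower K M2)) (lower K N) z <->
    lower K (add_set (add_set M1 M2) N) (z - w).
  rewrite lowM1w !lowerD//; split.
    move=> [_ [a /= Ma [b Mb <-]] [c Nc <-]].
    exists (a - w + b); first by exists (a - w) => //; exists b.
    by exists c => //; rewrite (addrAC a) (addrAC _ (- w)).
  move=> [_ [a Ma [b Mb <-]] [c Nc /esym/(canRL (subrK _)) ->]].
  exists (a + w + b); first by exists (a + w); rewrite /= ?addrK//; exists b.
  by exists c => //; rewrite (addrAC a) (addrAC _ w).
have PU1 : Pp K (WSup K M1w) by exact: WSup_Pp.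
have PU2 : Pp K (WSup K M2) by exact: WSup_Pp.
(* Only the first component is shifted; the second is the conjugate of [E2] at [L - L'] itself. *)
exists (L, uplus K (uplus K (WSup K M1w) (WSup K M2)) N).
  exists (L, uplus K (WSup K M1w) (WSup K M2)); last first.
    by exists (0, N); rewrite //= addr0.
  exists (L', WSup K M1w).
    split=> //=; first exact/dom_conjugateP.
    by apply: set_le_WSup => // z /Kw; rewrite lowM1w.
  exists (L - L', WSup K M2).
    split=> //=; first by apply/dom_conjugateP => //; split=> //; exact: clinB.
    exact: set_le_WSup.
  by rewrite /= addrC subrK.
split=> //=; apply/uplus_fin => //.
  by rewrite lower_uplus ?lower_WSup//; exact: minkowski_neq0.
rewrite lower_uplus ?lower_WSup//.
split=> [/mink_shift//|k Ik]; apply/mink_shift.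
by rewrite addrAC; exact: Fy.
Qed.
End Conjugates.

(** * The assertions expressed through strict lower sets *)

Section CompositeProblem.
Context {R : realType} {X Y Z W : tvsType R}.
Context (K : set Y) (S : set Z).
Context (F : X -> \bar Y) (kappa : W -> \bar Y).
Context (H : X -> \bar W) (G : X -> \bar Z) (C : set X).
Context (coneK : convex_cone K) (intK : interior K !=set0).
Context (Fno : forall x, F x <> -oo%E) (kno : forall w, kappa w <> -oo%E).

Lemma indicator_in (T : Type) (V : nmodType) (D : set T) x :
  D x -> indicator D x = 0%:E%E :> \bar V.
Proof. by move=> Dx; rewrite /indicator mem_set. Qed.

Lemma indicator_notin (T : Type) (V : nmodType) (D : set T) x :
  ~ D x -> indicator D x = +oo%E :> \bar V.
Proof. by move=> Dx; rewrite /indicator memNset. Qed.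

Lemma ext_comp_neqNy (T U V : Type) (f : U -> \bar V) (E : T -> \bar U) x :
  (forall u, f u <> -oo%E) -> ext_comp f E x <> -oo%E.
Proof. by move=> fno; rewrite /ext_comp; case: (E x). Qed.

(** Where the objective is [+oo], its value in the conjugate is [-oo] and has nothing below it;
    elsewhere both sides concern the same difference of vectors. *)
Lemma assertion_alphaP (L : X -> Y) y :
  assertion_alpha K S F kappa H G C L y <->
  ~ lower K (values (objective S F kappa H G C) L) y.
Proof.
rewrite /assertion_alpha /values /objective; split.
  move=> al [_ [x _ <-]].
  have := ext_comp_neqNy (E := H) (x := x) (@kno); have := @Fno x; move: (al x).
  have [[Cx Gx]|nA] := pselect (feasible S G C x).
    rewrite indicator_in// => /(_ Cx Gx).
    case: (F x) => [a| |]//; case: (ext_comp _ _ _) => [b| |]//.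
    move=> h _ _ /ltK_fin Iy.
    apply: h; exists (a + b - L x + y) => //.
    exists (L x - (a + b + 0) - y) => //.
    by rewrite addr0 !opprB addrC.
  by rewrite indicator_notin//; case: (F x) => [a| |]//; case: (ext_comp _ _ _).
move=> nlow x Cx Gx [_ [k Ik <-]] e; apply: nlow.
exists ((L x)%:E - (F x + ext_comp kappa H x + indicator (feasible S G C) x))%E.
  by exists x.
move: e; rewrite indicator_in//.
case: (F x) => [a| |]//; case: (ext_comp _ _ _) => [b| |]// [e].
apply/ltK_fin; rewrite addr0 (_ : _ - _ = k)//.
by rewrite -[RHS]opprK e [RHS]opprD opprB.
Qed.

(** Finiteness of [N] matters: an element [+oo] could put every [y] in the lower set without
    excluding any finite decoupled value. *)
Lemma decoupledP (N : set (\bar Y)) (L L' : X -> Y) T1 T2 y :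
  (forall u, N u -> exists v, u = v%:E%E) ->
  (forall x x', C x' -> ~ add_set N (EFin @` opp_set (interior K))
     (decoupled F H G L L' T1 T2 y x x')) <->
  ~ lower K (add_set (add_set (values F L')
               (values (lagrangian H G C T1 T2) (L - L'))) N) y.
Proof.
move=> Nfin.
(* The letters stand for [F x], [L' x], the [T1] and [T2] terms, [(L - L') x'] and an element of
   [N]; the [0] is the indicator on [C]. *)
have eq_gap (a l p q m n : Y) :
    l - a + (m - (p + q + 0)) + n - y = n - (a - l + p + q - m + y).
  rewrite addr0 !opprD !opprK !addrA.
  by rewrite [RHS](ACl (3*2*6*4*5*1*7)).
rewrite /decoupled /values /lagrangian; split.
  move=> dec [_ [_ [_ [x _ <-] [_ [x' _ <-] <-]] [u Nu <-]]].
  have [n un] := Nfin u Nu; rewrite {}un in Nu *.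
  have := @Fno x; move: (dec x x'); rewrite /ext_comp.
  have [Cx|nC] := pselect (C x'); last first.
    by rewrite indicator_notin//; case: (F x) => [a| |]//;
      case: (H x'); case: (G x').
  rewrite indicator_in// => /(_ Cx).
  case: (F x) => [a| |]//; case: (H x') => [p| |]//; case: (G x') => [q| |]//.
  move=> h _ /ltK_fin; rewrite eq_gap => I; apply: h.
  exists n%:E%E => //; set d := n - _ in I; exists (- d)%:E%E.
    by exists (- d) => //; exists d.
  by congr EFin; rewrite /d opprB addrC subrK.
move=> nlow x x' Cx [u Nu [_ [_ [k Ik <-] <-]]].
have [n un] := Nfin u Nu; rewrite {}un in Nu *.
move=> e; apply: nlow.
pose l' := ((L' x)%:E - F x)%E.
pose l := (((L - L') x')%:E -
  (ext_comp (EFin \o T1) H x' + ext_comp (EFin \o T2) G x'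
     + indicator C x'))%E.
exists (l' + l + n%:E)%E.
  exists (l' + l)%E; last by exists n%:E%E.
  by exists l'; [exists x|exists l; [exists x'|]].
move: e; rewrite /l /l' indicator_in// /ext_comp.
case: (F x) => [a| |]//; case: (H x') => [p| |]//; case: (G x') => [q| |]// [e].
by apply/ltK_fin; rewrite eq_gap -e opprB addrC subrK.
Qed.
End CompositeProblem.

(** * Indicator conjugates and the two equivalences *)

(** Points outside [D] contribute only [-oo]. This turns the conjugate of the indicator of [-S] in
    [M2] into the set [T2(-S)] of (delta'). *)
Lemma lower_indicator_values (R : realType) (Z Y : tvsType R) (K : set Y)
    (D : set Z) (T : Z -> Y) :
  lower K (values (indicator D) T) = lower K (EFin @` (T @` D)).
Proof.
apply/seteqP; split=> y.
  move=> [_ [z _ <-]]; have [Dz|nD] := pselect (D z); last first.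
    by rewrite indicator_notin.
  rewrite indicator_in// => yz.
  exists (T z)%:E%E; first by exists (T z) => //; exists z.
  by move: yz => /ltK_fin; rewrite subr0 => yz; apply/ltK_fin.
move=> [_ [_ [z Dz <-] <-] yz]; exists ((T z)%:E - indicator D z)%E.
  by exists z.
by rewrite indicator_in//; apply/ltK_fin; rewrite subr0; apply/ltK_fin.
Qed.

Lemma eq_set_cond (A B : Type) (E M : set (A * B)) (c : set A)
    (P Q : A -> B -> Prop) :
  (forall a b, E (a, b) <-> c a /\ P a b) ->
  (forall a b, M (a, b) <-> c a /\ Q a b) ->
  E = M <-> (forall a b, c a -> (P a b <-> Q a b)).
Proof.
move=> EP MQ; split=> [EM a b ca|PQ].
  have := EP a b; rewrite EM => EP'.
  by split=> h; [have /MQ[] := EP'.2 (conj ca h)|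
                 have /EP'[] := (MQ a b).2 (conj ca h)].
apply/seteqP; split=> -[a b].
  by move=> /EP[ca h]; apply/MQ; split=> //; apply/(PQ _ _ ca).
by move=> /MQ[ca h]; apply/EP; split=> //; apply/(PQ _ _ ca).
Qed.

Theorem corollary5p6 (R : realType) (X Y Z W : tvsType R)
    (K : set Y) (P : set W) (S : set Z)
    (F : X -> \bar Y) (kappa : W -> \bar Y)
    (H : X -> \bar W) (G : X -> \bar Z) (C : set X)
    (hausX : hausdorff_space X) (hausY : hausdorff_space Y)
    (hausZ : hausdorff_space Z) (hausW : hausdorff_space W)
    (coneK : convex_cone K) (closedK : closed K) (properK : K <> setT)
    (intK : interior K !=set0)
    (coneP : convex_cone P) (P0 : P !=set0)
    (coneS : convex_cone S) (S0 : S !=set0)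
    (properF : proper_map F) (properkappa : proper_map kappa)
    (properH : proper_map H) (properG : proper_map G)
    (C0 : C !=set0)
    (qualification :
       feasible S G C `&` dom F `&` H @^-1` (EFin @` dom kappa) !=set0) :
  (epi_conjugate K (objective S F kappa H G C) = M2 K S F kappa H G C <->
   (forall (L : X -> Y) (y : Y), clin L ->
      (assertion_alpha K S F kappa H G C L y <->
       assertion_delta K S F kappa H G C L y)))
  /\
  (epi_conjugate K (objective S F kappa H G C) = M2_pos K P S F kappa H G C <->
   (forall (L : X -> Y) (y : Y), clin L ->
      (assertion_alpha K S F kappa H G C L y <->
       assertion_epsilon K P S F kappa H G C L y))).
Proof.
have [Fno dF] := properF; have [kno dk] := properkappa.
have [x0 [[[Cx0 [z0 Sz0 Gx0]] Fx0] [w0 kw0 Hx0]]] := qualification.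
(* The qualification point lies in [C] and has finite images under [H] and [G], so it serves for all
   multipliers at once. *)
have dlag (T1 : W -> Y) (T2 : Z -> Y) : dom (lagrangian H G C T1 T2) !=set0.
  exists x0; rewrite /dom /lagrangian /= indicator_in// /ext_comp.
  by rewrite -Hx0 -Gx0.
have dobj : dom (objective S F kappa H G C) !=set0.
  exists x0; rewrite /dom /objective /= indicator_in; last first.
    by split=> //; exists z0.
  move: (@Fno x0) Fx0 (@kno w0) kw0; rewrite /ext_comp -Hx0 /dom /=.
  by case: (F x0) => [a| |]//; case: (kappa w0).
have dS : dom (indicator (opp_set S) : Z -> \bar Y) !=set0.
  by have [s Ss] := S0; exists (- s); rewrite /dom /= indicator_in//; exists s.
have epiE L y : epi_conjugate K (objective S F kappa H G C) (L, y) <->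
    clin L /\ assertion_alpha K S F kappa H G C L y.
  by rewrite assertion_alphaP//; exact: epi_conjugateP.
split; apply: eq_set_cond epiE _ => L y.
  have lowN T1 T2 : lower K (uplus K (conjugate K kappa T1)
        (conjugate K (indicator (opp_set S)) T2)) =
      lower K (add_set (conjugate K kappa T1) (EFin @` (T2 @` opp_set S))).
    rewrite lower_uplus ?lower_conjugate//; try exact: lower_values_neq0.
    by rewrite lowerD// lower_conjugate// lower_indicator_values.
  have lowN0 T1 T2 : lower K (uplus K (conjugate K kappa T1)
        (conjugate K (indicator (opp_set S)) T2)) !=set0.
    by rewrite lower_uplus ?lower_conjugate//; try apply: minkowski_neq0;
       exact: lower_values_neq0.
  (* Membership of [T1] in the domain of the conjugate of [kappa] is what makes the subtracted set
     finite. *)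
  have Nfin T1 T2 : dom_conjugate K kappa T1 -> forall u,
      add_set (conjugate K kappa T1) (EFin @` (T2 @` opp_set S)) u ->
      exists v, u = v%:E%E.
    move=> dT1 _ [a ca [_ [c _ <-] <-]].
    have [b ->] := dom_conjugate_fin coneK intK dk dT1 ca.
    by exists (b + c).
  split.
    move=> [T1 dT1 [T2 wT2]] psi.
    have [cL [L' cL' h]] :=
      (Psi_boxplusP coneK intK _ _ dF (dlag T1 T2) (lowN0 T1 T2)).1 psi.
    split=> //; exists L', T1, T2; split=> //.
    apply/decoupledP => //; first exact: Nfin.
    by move: h; rewrite lowerD// lowN -lowerD.
  move=> [cL [L' [T1 [T2 [cL' dT1 wT2 h]]]]].
  exists T1 => //; exists T2 => //; apply/Psi_boxplusP => //.
  split=> //; exists L' => //; rewrite lowerD// lowN -lowerD//.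
  by apply/decoupledP => //; exact: Nfin.
(* For (epsilon') the subtracted set is the conjugate of [kappa] alone, so no indicator term has to
   be converted. *)
have lowN0 T1 : lower K (conjugate K kappa T1) !=set0.
  by rewrite lower_conjugate//; exact: lower_values_neq0.
have Nfin T1 : dom_conjugate K kappa T1 -> forall u,
    conjugate K kappa T1 u -> exists v, u = v%:E%E.
  by move=> dT1 u; exact: dom_conjugate_fin.
split.
  move=> [T1 [dT1 pT1] [T2 pT2]] psi.
  have [cL [L' cL' h]] :=
    (Psi_boxplusP coneK intK _ _ dF (dlag T1 T2) (lowN0 T1)).1 psi.
  split=> //; exists L', T1, T2; split=> //.
  by apply/decoupledP => //; exact: Nfin.
move=> [cL [L' [T1 [T2 [cL' [dT1 pT1] pT2 h]]]]].
exists T1 => //; exists T2 => //; apply/Psi_boxplusP => //.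
split=> //; exists L' => //; apply/decoupledP => //; exact: Nfin.
Qed.
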